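(* Let $M,N,\lambda,\xi=(\xi_m)_m,\psi_1,\psi_2,\phi_1,\phi_2$ be as in the context, and let $\pi^{(\ell)}=(\pi^{(\ell)}_1,\dots,\pi^{(\ell)}_M)$, $z^{(\ell)}=(z^{(\ell)}_1,\dots,z^{(\ell)}_M)$ be the iterates of Dykstra's algorithm: $\pi^{(0)}=\xi$, $z_m^{(0)}=z_m^{(-1)}=\mathbf{1}\mathbf{1}^T$ for all $m$ and, for $\ell>0$, $$\pi^{(\ell)}=\mathrm{Prox}^{\mathrm{KL}_\lambda}_{\phi_{[\ell]_2}}(\pi^{(\ell-1)}\odot z^{(\ell-2)}),\qquad z^{(\ell)}=z^{(\ell-2)}\odot\frac{\pi^{(\ell-1)}}{\pi^{(\ell)}} .$$ Then, for all $m\in\{1,\dots,M\}$, $$\pi_m^{(\ell)}=\mathrm{diag}(a_m^{(\ell)})\,\xi_m\,\mathrm{diag}(b_m^{(\ell)})\qquad\text{and}\qquad z_m^{(\ell)}=u_m^{(\ell)}(v_m^{(\ell)})^T,$$ where the vectors $a_m^{(\ell)},b_m^{(\ell)},u_m^{(\ell)},v_m^{(\ell)}\in\mathbb{R}^N$ are initialized by $a_m^{(0)}=b_m^{(0)}=u_m^{(0)}=v_m^{(0)}=\mathbf{1}$, $u_m^{(-1)}=v_m^{(-1)}=\mathbf{1}$, and are updated for $\ell>0$ as follows. Set, for all $m$, $$\tilde a_m^{(\ell-1)}=a_m^{(\ell-1)}\odot u_m^{(\ell-2)},\qquad \tilde b_m^{(\ell-1)}=b_m^{(\ell-1)}\odot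 v_m^{(\ell-2)},$$ $$\tilde p_m=\begin{cases}\tilde a_m^{(\ell-1)}\odot\xi_m\tilde b_m^{(\ell-1)}&\text{if }[\ell]_2=1,\\ \tilde b_m^{(\ell-1)}\odot\xi_m^T\tilde a_m^{(\ell-1)}&\text{if }[\ell]_2=2,\end{cases}\qquad (p_m)_m=\mathrm{Prox}^{\overline{\mathrm{KL}}_\lambda}_{\psi_{[\ell]_2}}\big((\tilde p_m)_m\big).$$ Then, for all $m$, $$a_m^{(\ell)}=\begin{cases}\dfrac{p_m}{\xi_m\tilde b_m^{(\ell-1)}}&\text{if }[\ell]_2=1,\\ \tilde a_m^{(\ell-1)}&\text{if }[\ell]_2=2,\end{cases}\qquad b_m^{(\ell)}=\begin{cases}\tilde b_m^{(\ell-1)}&\text{if }[\ell]_2=1,\\ \dfrac{p_m}{\xi_m^T\tilde a_m^{(\ell-1)}}&\text{if }[\ell]_2=2,\end{cases}$$ $$u_m^{(\ell)}=u_m^{(\ell-2)}\odot\frac{a_m^{(\ell-1)}}{a_m^{(\ell)}},\qquad v_m^{(\ell)}=v_m^{(\ell-2)}\odot\frac{b_m^{(\ell-1)}}{b_m^{(\ell)}} .$$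
   Context: $\mathbf{1}=(1,\dots,1)^T\in\mathbb{R}^N$; $\odot$ and fractions denote entrywise product and division (applied componentwise to families of matrices); $[\ell]_2=1$ if $\ell$ is odd, $2$ if $\ell$ is even. $\lambda\in\mathbb{R}^M$ has strictly positive entries; $\xi=(\xi_1,\dots,\xi_M)\in(\mathbb{R}^{N\times N})^M$ has strictly positive entries; $\psi_1,\psi_2:(\mathbb{R}^N)^M\to(-\infty,+\infty]$ are proper lower semicontinuous convex functions. For $\pi=(\pi_1,\dots,\pi_M)\in(\mathbb{R}^{N\times N})^M$, $\phi_1(\pi)=\psi_1(\pi_1\mathbf{1},\dots,\pi_M\mathbf{1})$ and $\phi_2(\pi)=\psi_2(\pi_1^T\mathbf{1},\dots,\pi_M^T\mathbf{1})$. The algorithm is aimed at $\min_{\pi}\mathrm{KL}_\lambda(\pi|\xi)+\phi_1(\pi)+\phi_2(\pi)$. Standing qualification assumption: $\mathrm{ri}(\mathrm{dom}\,\phi_1)\cap\mathrm{ri}(\mathrm{dom}\,\phi_2)\cap\mathrm{ri}((\mathbb{R}_+^{N\times N})^M)\ne\emptyset$, with $\mathrm{ri}$ the relative interior and $\mathrm{dom}\,\phi=\{\phi\neq+\infty\}$. With the convention $0\log 0=0$, $\overline{\mathrm{KL}}(p|r)=\sum_i p_i\log(p_i/r_i)-p_i+r_i$ for vectors and $\mathrm{KL}(\pi|\zeta)=\sum_{i,j}\pi_{i,j}\log(\pi_{i,j}/\zeta_{i,j})-\pi_{i,j}+\zeta_{i,j}$ for matrices (first argument nonnegative, second strictly positive);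 $\overline{\mathrm{KL}}_\lambda((p_m)_m|(r_m)_m)=\sum_m\lambda_m\overline{\mathrm{KL}}(p_m|r_m)$ and $\mathrm{KL}_\lambda(\pi|\zeta)=\sum_m\lambda_m\mathrm{KL}(\pi_m|\zeta_m)$. The proximal operators are $$\mathrm{Prox}^{\overline{\mathrm{KL}}_\lambda}_{\psi}(r)=\mathrm{argmin}_{p\in(\mathbb{R}_+^N)^M}\overline{\mathrm{KL}}_\lambda(p|r)+\psi(p),\qquad \mathrm{Prox}^{\mathrm{KL}_\lambda}_{\phi}(\pi)=\mathrm{argmin}_{\tilde\pi\in(\mathbb{R}_+^{N\times N})^M}\mathrm{KL}_\lambda(\tilde\pi|\pi)+\phi(\tilde\pi).$$ *)

(* Defs.v *)
From HB Require Import structures.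
From mathcomp Require Import all_boot all_order all_algebra.
From mathcomp Require Import all_classical all_reals all_analysis.

Set Implicit Arguments.
Unset Strict Implicit.
Unset Printing Implicit Defensive.

Import Order.TTheory GRing.Theory Num.Theory.
Import numFieldNormedType.Exports.
Import ArrowAsProduct.

Local Open Scope classical_set_scope.
Local Open Scope ring_scope.

(* (R^(m x n))^M, with the product topology and the pointwise module
   structure; vectors of R^N are columns, so that (R^N)^M is mxfamily R M N 1. *)
Notation mxfamily R M m n := ('I_M -> 'M[R]_(m, n)).

(* Entrywise product and quotient, applied componentwise to families.
   x / 0 = 0 here, but no zero denominator occurs in the algorithm: under the
   qualification condition all the iterates have positive entries. *)
Definition fam_mul {R : realType} {M m n : nat} (x y : mxfamily R M m n) :
  mxfamily R M m n := fun k => map2_mx (fun s t : R => s * t) (x k) (y k).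

Definition fam_div {R : realType} {M m n : nat} (x y : mxfamily R M m n) :
  mxfamily R M m n := fun k => map2_mx (fun s t : R => s / t) (x k) (y k).

Definition fam_one {R : realType} {M m n : nat} : mxfamily R M m n :=
  fun=> const_mx 1.

Notation "x \odot y" := (fam_mul x y) (at level 40, left associativity).
Notation "x \oslash y" := (fam_div x y) (at level 40, left associativity).

(* x_{[l]_2}: x1 for odd l, x2 for even l. *)
Definition alt {T : Type} (l : int) (x1 x2 : T) : T :=
  if odd `|l|%N then x1 else x2.

Section Convexity.
Context {R : realType}.

Definition edom {T : Type} (f : T -> \bar R) : set T := [set x | f x != +oo%E].

(* Properness includes the fact that -oo is not a value. *)
Definition eproper {T : Type} (f : T -> \bar R) : Prop :=
  (forall x, (-oo < f x)%E) /\ edom f !=set0.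

Definition econvex {E : lmodType R} (f : E -> \bar R) : Prop :=
  forall (x y : E) (t : R), 0 <= t <= 1 ->
    (f (t *: x + (1 - t) *: y)%R <= t%:E * f x + (1 - t)%:E * f y)%E.

Definition affine_hull {E : lmodType R} (A : set E) : set E :=
  [set x | exists (k : nat) (c : 'I_k -> R) (y : 'I_k -> E),
    [/\ forall i, A (y i), \sum_i c i = 1 & x = \sum_i c i *: y i]].

(* Interior of A with respect to the topology induced on its affine hull. *)
Definition relative_interior {M m n : nat} (A : set (mxfamily R M m n)) :
    set (mxfamily R M m n) :=
  [set x | affine_hull A x /\ within (affine_hull A) (nbhs x) A].

Definition argmin {T : Type} (A : set T) (f : T -> \bar R) : set T :=
  [set x | A x /\ forall y, A y -> (f x <= f y)%E].

End Convexity.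

Section Prox.
Context {R : realType}.

Definition nonneg_family {M m n : nat} : set (mxfamily R M m n) :=
  [set x | forall k i j, 0 <= x k i j].

(* Both divergences: for matrices, and for vectors when n = 1. The convention
   0 log 0 = 0 holds because ln is a total function. *)
Definition KL {m n : nat} (p r : 'M[R]_(m, n)) : R :=
  \sum_(i < m) \sum_(j < n) (p i j * ln (p i j / r i j) - p i j + r i j).

Definition KL_weighted {M m n : nat} (lambda : 'I_M -> R)
    (p r : mxfamily R M m n) : R :=
  \sum_(k < M) lambda k * KL (p k) (r k).

(* The minimizer exists and is unique when f is proper, lower semicontinuous
   and convex, r is positive and f is finite at some positive point; outside
   this setting the value is unspecified. *)
Definition prox {M m n : nat} (lambda : 'I_M -> R)
    (f : mxfamily R M m n -> \bar R) (r : mxfamily R M m n) : mxfamily R M m n :=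
  get (argmin nonneg_family (fun p => ((KL_weighted lambda p r)%:E + f p)%E)).

End Prox.

Section Algorithms.
Context {R : realType} {M N : nat}.

(* (pi_1 1, ..., pi_M 1) and (pi_1^T 1, ..., pi_M^T 1). *)
Definition row_marginals (pi : mxfamily R M N N) : mxfamily R M N 1 :=
  fun k => pi k *m const_mx 1.

Definition col_marginals (pi : mxfamily R M N N) : mxfamily R M N 1 :=
  fun k => (pi k)^T *m const_mx 1.

(* Sequences are indexed by int because z starts at l = -1; the values at
   l < 0 for pi and at l < -1 for z are irrelevant. *)
Definition dykstra_iterates (lambda : 'I_M -> R) (xi : mxfamily R M N N)
    (phi1 phi2 : mxfamily R M N N -> \bar R)
    (pi z : int -> mxfamily R M N N) : Prop :=
  [/\ pi 0 = xi, z 0 = fam_one, z (-1) = fam_one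
    & forall l : int, 0 < l ->
        pi l = prox lambda (alt l phi1 phi2) (pi (l - 1) \odot z (l - 2)) /\
        z l = z (l - 2) \odot (pi (l - 1) \oslash pi l)].

Definition scaling_step (lambda : 'I_M -> R) (xi : mxfamily R M N N)
    (psi1 psi2 : mxfamily R M N 1 -> \bar R)
    (a b u v : int -> mxfamily R M N 1) (l : int) : Prop :=
  let a' := a (l - 1) \odot u (l - 2) in
  let b' := b (l - 1) \odot v (l - 2) in
  let xib : mxfamily R M N 1 := fun k => xi k *m b' k in
  let xiTa : mxfamily R M N 1 := fun k => (xi k)^T *m a' k in
  let p' := alt l (a' \odot xib) (b' \odot xiTa) in
  let p := prox lambda (alt l psi1 psi2) p' in
  [/\ a l = alt l (p \oslash xib) a',
      b l = alt l b' (p \oslash xiTa),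
      u l = u (l - 2) \odot (a (l - 1) \oslash a l)
    & v l = v (l - 2) \odot (b (l - 1) \oslash b l)].

Definition scaling_iterates (lambda : 'I_M -> R) (xi : mxfamily R M N N)
    (psi1 psi2 : mxfamily R M N 1 -> \bar R)
    (a b u v : int -> mxfamily R M N 1) : Prop :=
  [/\ a 0 = fam_one /\ b 0 = fam_one,
      u 0 = fam_one /\ v 0 = fam_one,
      u (-1) = fam_one /\ v (-1) = fam_one
    & forall l : int, 0 < l -> scaling_step lambda xi psi1 psi2 a b u v l].

End Algorithms.

(* Main.v *)
Require Import Defs.
From HB Require Import structures.
From mathcomp Require Import all_boot all_order all_algebra.
From mathcomp Require Import all_classical all_reals all_analysis.
From mathcomp Require Import ring lra.
Import Order.TTheory GRing.Theory Num.Theory.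
Import numFieldNormedType.Exports.
Import ArrowAsProduct.
Local Open Scope classical_set_scope.
Local Open Scope ring_scope.

Set Implicit Arguments.
Unset Strict Implicit.
Unset Printing Implicit Defensive.

(** The proof rests on the chain rule of the entropy for row sums: if x has
row sums P and r has row sums Q, then
  KL(x | r) = KL(P | Q) + KL(x | diag(P / Q) r).
When phi depends on x through P only, the last term can be made zero without
changing P.  Minimizing KL(x | r) + phi(x) over matrices therefore amounts to
minimizing KL(P | Q) + psi(P) over vectors, and the matrix minimizer is the row
scaling diag(P / Q) r of r by the vector minimizer P
([KL_weighted_row_marginals], [argmin_row_marginals]).  Column sums reduce to
row sums by transposition ([argmin_tr]).

So if the argument of the proximal operator is diag(a) xi diag(b), its value is
diag(a') xi diag(b) or diag(a) xi diag(b'), where a' and b' are the vectors of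
the scaling iteration ([dykstra_row_step], [dykstra_col_step]).  An entrywise
product with a rank-one matrix keeps the form diag(a) xi diag(b), and in the
quotient of two matrices of this form xi cancels, which leaves a rank-one
matrix.  The two claimed factorizations thus propagate from step to step.

Both the cancellation of xi and the identification of the proximal points as
the minimizers need every vector minimizer to exist, to be unique and to have
positive entries ([prox_spec]).
- Existence: psi is bounded below by an affine function of the total mass, as a
  convex function bounded below on a box, while KL grows faster than linearly;
  a lower semicontinuous function has a minimum on a compact box.
- Positivity: KL has slope -oo where an entry vanishes, so moving from a
  minimizer with a zero entry towards a positive point of the domain of psi
  would decrease the objective.
- Uniqueness: strict convexity of KL.
The positive point of the domain comes from the qualification condition, since
the relative interior of the nonnegative families consists of positive
families ([relative_interior_nonneg]). *)

(** * The scalar divergence *)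

Definition kl {R : realType} (t r : R) : R := t * ln (t / r) - t + r.

Lemma kl0 (R : realType) (r : R) : kl 0 r = r.
Proof. by rewrite /kl mul0r subr0 add0r. Qed.

Lemma klxx (R : realType) (r : R) : 0 <= r -> kl r r = 0.
Proof.
rewrite le_eqVlt => /predU1P[<-|r0]; first by rewrite kl0.
by rewrite /kl divff ?gt_eqF// ln1 mulr0 add0r addNr.
Qed.

Lemma klE (R : realType) (t r : R) : 0 < t -> 0 < r ->
  kl t r = t * (expR (ln (r / t)) - 1 - ln (r / t)).
Proof.
move=> t0 r0; rewrite lnK ?posrE ?divr_gt0// /kl !ln_div ?posrE//.
by field; rewrite gt_eqF.
Qed.

(** Young's inequality, r * (exp c - 1) being the convex conjugate of kl(. , r)
at the slope c; it is 1 + y <= exp y taken at y = c + ln (r / t).  Large c gives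
superlinear growth in t. *)
Lemma kl_ge_tangent (R : realType) (c t r : R) : 0 <= t -> 0 < r ->
  c * t - r * (expR c - 1) <= kl t r.
Proof.
rewrite le_eqVlt => /predU1P[<- r0|t0 r0].
  rewrite kl0 mulr0; have := expR_ge0 c; nra.
have := expR_ge1Dx (c + ln (r / t)).
rewrite expRD lnK ?posrE ?divr_gt0// -(ler_pM2l t0).
rewrite (_ : t * (expR c * (r / t)) = expR c * r); last by field; rewrite gt_eqF.
rewrite /kl !ln_div ?posrE//; nra.
Qed.

Lemma kl_ge0 (R : realType) (t r : R) : 0 <= t -> 0 < r -> 0 <= kl t r.
Proof.
by move=> t0 r0; have := kl_ge_tangent 0 t0 r0; rewrite expR0 mul0r subrr mulr0 subr0.
Qed.

Lemma kl_eq0 (R : realType) (t r : R) : 0 <= t -> 0 < r -> kl t r = 0 -> t = r.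
Proof.
rewrite le_eqVlt => /predU1P[<- r0|t0 r0]; first by rewrite kl0.
rewrite klE// => /eqP; rewrite mulf_eq0 gt_eqF//= => /eqP h.
have [/eqP|/expR_gt1Dx] := eqVneq (ln (r / t)) 0; last by lra.
rewrite ln_eq0 ?divr_gt0// => /eqP e.
by rewrite -[LHS]mul1r -e divfK// gt_eqF.
Qed.

Lemma kl_change_ref (R : realType) (t m r : R) : 0 <= t -> 0 < m -> 0 < r ->
  kl t r = kl t m + t * ln (m / r) + r - m.
Proof.
rewrite le_eqVlt => /predU1P[<- m0 r0|t0 m0 r0].
  by rewrite !kl0; ring.
by rewrite /kl !ln_div ?posrE//; ring.
Qed.

(** The exact defect of convexity is itself a divergence, to the mean m, because
the change of reference from r to m is affine in the first argument.  Strict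
convexity and the infinite slope at 0 are both read off this formula. *)
Lemma kl_convex_combination (R : realType) (c s t m r : R) :
  0 < c < 1 -> 0 <= s -> 0 <= t -> 0 < r -> m = c * s + (1 - c) * t ->
  c * kl s r + (1 - c) * kl t r = kl m r + (c * kl s m + (1 - c) * kl t m).
Proof.
move=> /andP[c0 c1] s0 t0 r0 mE.
have [m0|] := ltP 0 m.
  rewrite (@kl_change_ref _ s m r)// (@kl_change_ref _ t m r)//.
  rewrite [kl m r]/kl; move: (ln (m / r)) (kl s m) (kl t m) => L ks kt; rewrite mE; ring.
(* A mean equal to 0 forces s = t = 0. *)
move=> m0.
have [s00 t00] : s = 0 /\ t = 0 by rewrite mE in m0; split; nra.
by rewrite mE s00 t00 !mulr0 addr0 !kl0; ring.
Qed.

(** At 0, write y = s ^ 2: then |y ln y| = 2 s * (s ln (1 / s)) <= 2 s, as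
ln (1 / s) < 1 / s.  On the negative side the function vanishes. *)
Lemma continuous_xlnx (R : realType) : continuous (fun x : R => x * ln x).
Proof.
move=> x; have [x0|x0|->] := ltgtP x 0.
- rewrite /continuous_at ln0 ?ltW// mulr0.
  apply: cvg_near_cst; near=> y; rewrite ln0 ?mulr0//.
  by near: y; apply: filterS (lt_nbhsl x0) => y /ltW.
- by apply: cvgM; [exact: cvg_id|exact: continuous_ln].
- rewrite /continuous_at mul0r; apply/cvgr0Pnorm_lt => e e0.
  have d0 : 0 < Num.min 1 (e / 2) ^+ 2 by rewrite exprn_gt0// lt_min ltr01 divr_gt0.
  near=> y.
  have [y0|y0] := leP y 0; first by rewrite ln0// mulr0 normr0.
  have yd : y < Num.min 1 (e / 2) ^+ 2.
    near: y; exact: lt_nbhsl.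
  set s := Num.sqrt y.
  have s0 : 0 < s by rewrite sqrtr_gt0.
  have sy : s ^+ 2 = y by rewrite sqr_sqrtr// ltW.
  have sd : s < Num.min 1 (e / 2).
    by rewrite -(@ltr_pXn2r _ 2)// ?sy// nnegrE ltW// lt_min ltr01 divr_gt0.
  move: sd; rewrite lt_min => /andP[s1 se].
  have h1 : - ln s < s^-1 by rewrite -lnV ?posrE// ln_sublinear// invr_gt0.
  have h2 : ln s < 0 by rewrite ln_lt0// s0 s1.
  rewrite -sy lnXn// ltr0_norm; last by rewrite pmulr_rlt0 ?exprn_gt0// mulrn_wlt0.
  have h3 : s * (- ln s) < 1 by rewrite -(mulfV (lt0r_neq0 s0)) ltr_pM2l.
  rewrite -mulr_natl; nra.
Unshelve. all: by end_near. Qed.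

Lemma continuous_kl (R : realType) (r : R) : 0 < r -> continuous (kl ^~ r).
Proof.
move=> r0.
rewrite (_ : kl ^~ r = fun t => r * ((t / r) * ln (t / r)) - t + r); last first.
  by apply/funext => t; rewrite /kl mulrA mulrCA divff ?gt_eqF// mulr1.
move=> x; apply: cvgD; last exact: cvg_cst.
apply: cvgB; last exact: cvg_id.
apply: cvgM; first exact: cvg_cst.
have dr : {for x, continuous (fun t : R => t / r)}.
  by apply: cvgM; [exact: cvg_id|exact: cvg_cst].
exact: (cvg_comp _ _ dr (@continuous_xlnx _ _)).
Qed.

(** * Minima of lower semicontinuous functions on boxes *)

(** The sublevel sets of f in A form a filter base; a cluster point of it lies,
by lower semicontinuity, in all of them. *)
Lemma lsc_attains_min (X : topologicalType) (R : realType) (f : X -> \bar R)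
    (A : set X) :
  compact A -> A !=set0 -> lower_semicontinuous f ->
  (forall x, (-oo < f x)%E) ->
  exists2 x, A x & forall y, A y -> (f x <= f y)%E.
Proof.
move=> cA [a Aa] lscf fNy.
pose sublevel y := [set x | A x /\ (f x <= f y)%E].
have FF : ProperFilter (filter_from A sublevel).
  apply: filter_from_proper; last by move=> y Ay; exists y.
  apply: filter_from_filter; first by exists a.
  move=> y z Ay Az; have [fyz|/ltW fzy] := leP (f y) (f z).
    by exists y => // x [Ax xy]; split; split => //; exact: le_trans fyz.
  by exists z => // x [Ax xz]; split; split => //; exact: le_trans fzy.
have [x [Ax clx]] : A `&` cluster (filter_from A sublevel) !=set0.
  by apply: cA; exists a => // x [].
exists x => // y Ay; rewrite leNgt; apply/negP => fyx.
have fy : f y \is a fin_num.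
  by rewrite fin_numElt fNy (lt_le_trans fyx)// leey.
have [|V xV Vf] := lscf x (fine (f y)); first by rewrite fineK.
have [z [[_ zy] /Vf]] : sublevel y `&` V !=set0 by apply: clx => //; exists y.
by rewrite fineK// ltNge zy.
Qed.

(** Image of a compact product of copies of A, given by Tychonoff's theorem. *)
Lemma mx_compact (R : realType) m n (A : set R) : compact A ->
  compact [set x : 'M[R]_(m, n) | forall i j, A (x i j)].
Proof.
move=> cA.
pose g (f : 'I_m * 'I_n -> R) : 'M[R]_(m, n) := \matrix_(i, j) f (i, j).
have cg : continuous g.
  move=> f V [P fP PV].
  have : \forall h \near f, forall ij : 'I_m * 'I_n, P ij.1 ij.2 (h ij).
    apply: (@filter_forall _ _ (fun (ij : _ * _) h => P ij.1 ij.2 (h ij))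
      (nbhs f) (nbhs_filter f)) => ij.
    have := @proj_continuous _ (fun=> R) ij f (P ij.1 ij.2); apply.
    by have := fP ij.1 ij.2; rewrite mxE -surjective_pairing.
  by apply: filterS => h Ph; apply: PV => i j; rewrite mxE; exact: (Ph (i, j)).
rewrite (_ : [set _ | _] = g @` [set f | forall ij, A (f ij)]); last first.
  apply/seteqP; split=> [x Ax|_ [f Af <-] i j]; last by rewrite mxE; exact: Af.
  by exists (fun ij => x ij.1 ij.2) => //; apply/matrixP => i j; rewrite mxE.
apply: continuous_compact; first exact: continuous_subspaceT.
exact: (@tychonoff _ (fun=> R) (fun=> A)).
Qed.

Definition box (R : realType) (M m n : nat) (d : R) : set (mxfamily R M m n) :=
  [set x | forall k i j, 0 <= x k i j <= d].

Lemma box_compact (R : realType) (M m n : nat) (d : R) : compact (@box R M m n d).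
Proof.
have := @tychonoff 'I_M (fun=> 'M[R]_(m, n))
  (fun=> [set x | forall i j, `[0, d]%classic (x i j)]).
rewrite (_ : [set _ | _] = @box R M m n d); last first.
  apply/seteqP; split=> x /= xd k i j; have := xd k i j;
  by rewrite /= in_itv.
by apply => _; apply: mx_compact; exact: segment_compact.
Qed.

(** * The weighted divergence of families *)

Definition pos_family {R : realType} {M m n : nat} : set (mxfamily R M m n) :=
  [set x | forall k i j, 0 < x k i j].

Lemma pos_family_nonneg (R : realType) (M m n : nat) (x : mxfamily R M m n) :
  pos_family x -> nonneg_family x.
Proof. by move=> x0 k i j; exact/ltW. Qed.

Section weighted_divergence.
Context {R : realType} {M m n : nat}.
Implicit Types (p q r : mxfamily R M m n) (lambda : 'I_M -> R).
Local Notation index := ('I_M * 'I_m * 'I_n)%type.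

(** A single sum over all the entries, so that entrywise facts transfer termwise. *)
Lemma KL_weightedE lambda p r : KL_weighted lambda p r =
  \sum_(x : index) lambda x.1.1 * kl (p x.1.1 x.1.2 x.2) (r x.1.1 x.1.2 x.2).
Proof.
rewrite -(pair_bigA _ (fun ki j => lambda ki.1 * kl (p ki.1 ki.2 j) (r ki.1 ki.2 j)))/=.
rewrite -(pair_bigA _ (fun k i => \sum_(j < n) lambda k * kl (p k i j) (r k i j)))/=.
apply: eq_bigr => k _; rewrite mulr_sumr; apply: eq_bigr => i _.
by rewrite mulr_sumr.
Qed.

Lemma KL_weighted_ge0 lambda p r : (forall k, 0 < lambda k) ->
  nonneg_family p -> pos_family r -> 0 <= KL_weighted lambda p r.
Proof.
move=> l0 p0 r0; rewrite KL_weightedE; apply: sumr_ge0 => x _.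
by apply: mulr_ge0; [exact: ltW|exact: kl_ge0].
Qed.

Lemma KL_weighted_ge_entry lambda p r k i j : (forall k, 0 < lambda k) ->
  nonneg_family p -> pos_family r ->
  lambda k * kl (p k i j) (r k i j) <= KL_weighted lambda p r.
Proof.
move=> l0 p0 r0; rewrite KL_weightedE (bigD1 (k, i, j))//= lerDl.
apply: sumr_ge0 => x _; by apply: mulr_ge0; [exact: ltW|exact: kl_ge0].
Qed.

Lemma KL_weighted_eq0 lambda p r : (forall k, 0 < lambda k) ->
  nonneg_family p -> pos_family r -> KL_weighted lambda p r <= 0 -> p = r.
Proof.
move=> l0 p0 r0 KL0; apply/funext => k; apply/matrixP => i j.
apply: kl_eq0 => //; apply/eqP; rewrite eq_le kl_ge0// andbT.
rewrite -(pmulr_rle0 _ (l0 k)); apply: le_trans KL0.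
exact: KL_weighted_ge_entry.
Qed.

Lemma KL_weightedxx lambda r : nonneg_family r -> KL_weighted lambda r r = 0.
Proof.
by move=> r0; rewrite KL_weightedE big1// => x _; rewrite klxx ?mulr0.
Qed.

Lemma KL_weighted_convex_combination lambda (c : R) p q r :
  0 < c < 1 -> nonneg_family p -> nonneg_family q -> pos_family r ->
  let mid := c *: p + (1 - c) *: q in
  c * KL_weighted lambda p r + (1 - c) * KL_weighted lambda q r =
  KL_weighted lambda mid r +
    (c * KL_weighted lambda p mid + (1 - c) * KL_weighted lambda q mid).
Proof.
move=> c01 p0 q0 r0 mid; rewrite !KL_weightedE !mulr_sumr -!big_split/=.
apply: eq_bigr => x _; rewrite !(mulrCA _ (lambda _)) -!mulrDr; congr (_ * _).
by apply: kl_convex_combination => //; rewrite /mid !mxE.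
Qed.

(** The slope c / lambda_k in the block k makes the weighted tangents add up to a
multiple of the total mass. *)
Lemma KL_weighted_superlinear lambda (c : R) r :
  (forall k, 0 < lambda k) -> pos_family r ->
  exists C, forall p, nonneg_family p ->
    c * (\sum_(x : index) p x.1.1 x.1.2 x.2) - C <= KL_weighted lambda p r.
Proof.
move=> l0 r0.
exists (\sum_(x : index)
  lambda x.1.1 * (r x.1.1 x.1.2 x.2 * (expR (c / lambda x.1.1) - 1))) => p p0.
rewrite KL_weightedE mulr_sumr -sumrB; apply: ler_sum => x _.
have lx := l0 x.1.1.
have tangent :=
  kl_ge_tangent (c / lambda x.1.1) (p0 x.1.1 x.1.2 x.2) (r0 x.1.1 x.1.2 x.2).
rewrite -(ler_pM2l lx) in tangent; apply: le_trans tangent.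
rewrite le_eqVlt; apply/orP; left; apply/eqP.
by field; rewrite gt_eqF.
Qed.

Lemma entry_continuous k i j : continuous (fun p : mxfamily R M m n => p k i j).
Proof.
move=> p.
have pk := @proj_continuous _ (fun=> 'M[R]_(m, n)) k p.
exact: (cvg_comp _ _ pk (@coord_continuous _ _ _ i j _)).
Qed.

Lemma KL_weighted_continuous lambda r : pos_family r ->
  continuous (fun p => KL_weighted lambda p r).
Proof.
move=> r0; have /funext -> := (fun p => KL_weightedE lambda p r).
apply: continuous_big => [|x _ p]; first exact: add_continuous.
have FF : Filter (nbhs p) := nbhs_filter p.
apply: cvgM; first exact: (@cvg_cst _ _ _ _ FF).
have := continuous_kl (r0 x.1.1 x.1.2 x.2) (x := p x.1.1 x.1.2 x.2).
exact: cvg_comp (@entry_continuous x.1.1 x.1.2 x.2 p).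
Qed.

End weighted_divergence.

(** * Existence, positivity and uniqueness of proximal points *)

Section proximal_point.
Context {R : realType} {M m n : nat}.
Local Notation family := (mxfamily R M m n).
Local Notation index := ('I_M * 'I_m * 'I_n)%type.
Implicit Types (p q r : family) (psi : family -> \bar R).

Definition total p : R := \sum_(x : index) p x.1.1 x.1.2 x.2.

Lemma entry_le_total p k i j : nonneg_family p -> p k i j <= total p.
Proof.
by move=> p0; rewrite /total (bigD1 (k, i, j))//= lerDl sumr_ge0.
Qed.

(** The minimum of psi on a box around x0, extended by convexity along the rays
issued from x0, gives the bound without any separation theorem. *)
Lemma econvex_minorant psi x0 :
  (forall p, (-oo < psi p)%E) -> lower_semicontinuous psi -> econvex psi ->
  nonneg_family x0 -> edom psi x0 ->
  exists a c : R, forall y, nonneg_family y ->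
    ((a - c * total y)%:E <= psi y)%E.
Proof.
move=> psiNy lsc_psi cvx_psi x00 /= psix0.
have total_ge0 y : nonneg_family y -> 0 <= total y.
  by move=> y0; apply: sumr_ge0.
pose B := @box R M m n (1 + total x0).
have Bx0 : B x0.
  move=> k i j; rewrite x00 (le_trans (entry_le_total k i j x00))//.
  by rewrite lerDr.
have [w Bw wmin] := lsc_attains_min (@box_compact R M m n (1 + total x0))
  (ex_intro _ x0 Bx0) lsc_psi psiNy.
have fx0 : psi x0 \is a fin_num by rewrite fin_numElt psiNy ltey.
have fw : psi w \is a fin_num.
  by rewrite fin_numElt psiNy (le_lt_trans (wmin _ Bx0))// ltey.
exists (fine (psi w)), (fine (psi x0) - fine (psi w)) => y y0.
have [->|psiy] := eqVneq (psi y) +oo%E; first by rewrite leey.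
have fy : psi y \is a fin_num by rewrite fin_numElt psiNy ltey.
have s0 := total_ge0 _ y0.
have t0 : 0 < 1 + total y by rewrite ltr_wpDr.
(* This step brings x0 + c (y - x0) into the box, whatever the size of y. *)
pose c := (1 + total y)^-1.
have c0 : 0 < c by rewrite invr_gt0.
have c1 : c <= 1 by rewrite invf_le1// lerDl.
have ct : c * (1 + total y) = 1 by rewrite mulVf// gt_eqF.
have Bz : B (c *: y + (1 - c) *: x0).
  move=> k i j; rewrite !mxE.
  have := entry_le_total k i j y0; have := entry_le_total k i j x00.
  have := y0 k i j; have := x00 k i j; have := total_ge0 _ x00.
  by move=> h1 h2 h3 h4 h5; apply/andP; split; nra.
have := le_trans (wmin _ Bz) (cvx_psi y x0 c _); rewrite (ltW c0) c1 => /(_ isT).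
rewrite -(fineK fx0) -(fineK fw) -(fineK fy) -!EFinM -EFinD !lee_fin/=.
move: (fine (psi w)) (fine (psi x0)) (fine (psi y)) => mw mx my.
rewrite -(ler_pM2l t0) => h.
apply: le_trans (_ : (1 + total y) * mw - total y * mx <= _).
  by rewrite le_eqVlt; apply/orP; left; apply/eqP; ring.
rewrite lerBlDr (le_trans h)// le_eqVlt; apply/orP; left; apply/eqP.
by rewrite /c; field; rewrite gt_eqF.
Qed.

Definition objective (lambda : 'I_M -> R) psi r p : \bar R :=
  ((KL_weighted lambda p r)%:E + psi p)%E.

Lemma objective_lsc lambda psi r : pos_family r -> (forall p, (-oo < psi p)%E) ->
  lower_semicontinuous psi -> lower_semicontinuous (objective lambda psi r).
Proof.
move=> r0 psiNy lsc_psi p a; rewrite /objective => aF.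
(* Split the level a between the divergence and psi. *)
have [b ab bpsi] : exists2 b, a - KL_weighted lambda p r < b & (b%:E < psi p)%E.
  have := psiNy p; case: (psi p) aF => [s| |]//.
    rewrite -EFinD lte_fin => h _; exists ((a - KL_weighted lambda p r + s) / 2).
      by lra.
    by rewrite lte_fin; lra.
  by move=> _ _; exists (a - KL_weighted lambda p r + 1); [lra|exact: ltry].
have [V pV Vb] := lsc_psi _ _ bpsi.
exists (V `&` [set q | a - b < KL_weighted lambda q r]).
  apply: filterI => //.
  have /(_ [set y | a - b < y]) := @KL_weighted_continuous _ _ _ _ lambda r r0 p.
  by apply; apply: lt_nbhsr; lra.
move=> q [/Vb bq /= aq]; have := psiNy q; case: (psi q) bq => [s| |]//.
  by rewrite -EFinD !lte_fin => h _; lra.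
by move=> _ _; rewrite addey// ltry.
Qed.

Variables (lambda : 'I_M -> R) (psi : family -> \bar R) (r x0 : family).
Hypotheses (lambda_gt0 : forall k, 0 < lambda k) (r_gt0 : pos_family r).
Hypotheses (psiNy : forall p, (-oo < psi p)%E) (psi_lsc : lower_semicontinuous psi).
Hypotheses (psi_cvx : econvex psi).
Hypotheses (x0_gt0 : pos_family x0) (x0_dom : edom psi x0).

Local Notation F := (objective lambda psi r).

Lemma objective_fin p : edom psi p ->
  F p = (KL_weighted lambda p r + fine (psi p))%:E.
Proof.
by move=> /= pdom; rewrite /objective EFinD fineK// fin_numElt psiNy ltey.
Qed.

(** Divergence of slope 1 + c against a minorant of slope - c: outside a box the
objective exceeds its value at x0. *)
Lemma argmin_exists : exists p, argmin nonneg_family F p.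
Proof.
have x0_ge0 := pos_family_nonneg x0_gt0.
have [a [c minor]] := econvex_minorant psiNy psi_lsc psi_cvx x0_ge0 x0_dom.
have [C superlin] := KL_weighted_superlinear (1 + c) lambda_gt0 r_gt0.
have Fx0 := objective_fin x0_dom.
set f0 := _ + _ in Fx0.
pose d := total x0 + `|f0 - a + C|.
have Bx0 : box d x0.
  move=> k i j; rewrite x0_ge0/= (le_trans (entry_le_total k i j x0_ge0))//.
  by rewrite lerDl.
have FNy p : (-oo < F p)%E.
  have := psiNy p; rewrite /objective; case: (psi p) => [s| |]// _.
  by rewrite -EFinD ltNyr.
have [p Bp pmin] := lsc_attains_min (@box_compact R M m n d)
  (ex_intro _ x0 Bx0) (objective_lsc r_gt0 psiNy psi_lsc) FNy.
exists p; split; first by move=> k i j; have /andP[] := Bp k i j.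
move=> q q0; have [Bq|nBq] := pselect (box d q); first exact: pmin.
apply: (le_trans (pmin _ Bx0)); rewrite Fx0.
have dq : d < total q.
  rewrite ltNge; apply/negP => qd; apply: nBq => k i j.
  by rewrite q0/= (le_trans (entry_le_total k i j q0)).
have := superlin _ q0; have := minor _ q0; have := psiNy q.
rewrite /objective -/(total q).
case: (psi q) => [s| |]//; last by move=> _ _ _; rewrite addey// leey.
rewrite -EFinD !lee_fin => _ h1 h2.
have h3 := ler_norm (f0 - a + C).
have h4 : 0 <= total x0 by apply: sumr_ge0.
by move: dq; rewrite /d; lra.
Qed.

Lemma argmin_dom p : argmin nonneg_family F p -> edom psi p.
Proof.
move=> [p0 /(_ x0 (pos_family_nonneg x0_gt0))]; rewrite (objective_fin x0_dom) /objective.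
by apply: contraPneq => ->; rewrite addey.
Qed.

(** Moving from a minimizer p towards q does not decrease the objective, whereas
convexity of psi lets it increase by at most the chord, less the convexity
defect of the divergence.  Hence the defect is bounded by the chord. *)
Lemma argmin_convex_combination (c : R) p q mid :
  argmin nonneg_family F p -> nonneg_family q -> edom psi q -> 0 < c < 1 ->
  mid = c *: p + (1 - c) *: q ->
  c * KL_weighted lambda p mid + (1 - c) * KL_weighted lambda q mid <=
  (1 - c) * (fine (F q) - fine (F p)).
Proof.
move=> pmin q0 qdom c01 midE; have pdom := argmin_dom pmin.
have [p0 pF] := pmin; have /andP[c0 c1] := c01.
have mid0 : nonneg_family mid.
  move=> k i j; rewrite midE !mxE; have := p0 k i j; have := q0 k i j; nra.
have := psi_cvx p q; move=> /(_ c); rewrite (ltW c0) (ltW c1) => /(_ isT).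
rewrite -midE => cvx.
have fp : psi p \is a fin_num by rewrite fin_numElt psiNy ltey.
have fq : psi q \is a fin_num by rewrite fin_numElt psiNy ltey.
have middom : edom psi mid.
  apply/eqP => midy; move: cvx; rewrite midy -(fineK fp) -(fineK fq).
  by rewrite -!EFinM -EFinD.
have fm : psi mid \is a fin_num by rewrite fin_numElt psiNy ltey.
have := pF _ mid0; rewrite !objective_fin// lee_fin.
have := KL_weighted_convex_combination lambda c01 p0 q0 r_gt0.
move: cvx; rewrite -midE -(fineK fp) -(fineK fq) -(fineK fm) -!EFinM -EFinD lee_fin/=.
nra.
Qed.

(** Suppose p vanishes at an entry and move by e towards x0.  Then the convexity
defect is at least e * lambda * kl(x0, e x0), of order e * |ln e|, while the
chord is only of order e. *)
Lemma argmin_pos p : argmin nonneg_family F p -> pos_family p.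
Proof.
move=> pmin k i j; have [p0 _] := pmin.
rewrite lt_neqAle p0 andbT eq_sym; apply/eqP => pkij.
have x0_ge0 := pos_family_nonneg x0_gt0.
set G := fine (F x0) - fine (F p).
set l := lambda k * x0 k i j.
have l0 : 0 < l by rewrite mulr_gt0.
(* Chosen so that l * (- ln e - 1) = `|G| + 1 exceeds the slope G of the chord. *)
pose e := expR (- (1 + (`|G| + 1) / l)).
have e0 : 0 < e := expR_gt0 _.
have e1 : e < 1.
  by rewrite /e expR_lt1 oppr_lt0 ltr_pwDl// divr_ge0 ?ltW// ltr_wpDl.
have c01 : 0 < 1 - e < 1 by apply/andP; split; lra.
have := argmin_convex_combination pmin x0_ge0 x0_dom c01 erefl.
rewrite (_ : 1 - (1 - e) = e); last by ring.
set mid := (1 - e) *: p + e *: x0.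
have midE k' i' j' : mid k' i' j' = (1 - e) * p k' i' j' + e * x0 k' i' j'.
  by rewrite /mid !mxE.
have mid0 : pos_family mid.
  move=> k' i' j'; rewrite midE; have := p0 k' i' j'; have := x0_gt0 k' i' j'; nra.
have h1 := KL_weighted_ge0 lambda_gt0 p0 mid0.
have h2 := KL_weighted_ge_entry k i j lambda_gt0 x0_ge0 mid0.
have h3 : lambda k * kl (x0 k i j) (mid k i j) = l * e + (`|G| + 1).
  rewrite midE pkij mulr0 add0r /kl invfM mulrA (mulrAC _ e^-1).
  rewrite divff ?mul1r ?gt_eqF// lnV ?posrE// expRK /l.
  by field; rewrite !gt_eqF.
rewrite -/G; have := ler_norm G; nra.
Qed.

(** With equal values at p and q the chord is flat, so both divergences to the
midpoint vanish. *)
Lemma argmin_unique p q :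
  argmin nonneg_family F p -> argmin nonneg_family F q -> q = p.
Proof.
move=> pmin qmin; have [[p0 pF] [q0 qF]] := (pmin, qmin).
have c01 : 0 < (1 / 2 : R) < 1 by apply/andP; split; lra.
have := argmin_convex_combination pmin q0 (argmin_dom qmin) c01 erefl.
have -> : F q = F p by apply/eqP; rewrite eq_le pF// qF.
set mid := (1 / 2) *: p + _; rewrite subrr mulr0 => h.
have mid0 : pos_family mid.
  move=> k i j; rewrite /mid !mxE.
  by have := argmin_pos pmin k i j; have := argmin_pos qmin k i j; lra.
have h1 := KL_weighted_ge0 lambda_gt0 p0 mid0.
have h2 := KL_weighted_ge0 lambda_gt0 q0 mid0.
rewrite (KL_weighted_eq0 lambda_gt0 p0 mid0); last by lra.
by apply: (KL_weighted_eq0 lambda_gt0 q0 mid0); lra.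
Qed.

End proximal_point.

Lemma prox_spec (R : realType) (M m n : nat) (lambda : 'I_M -> R)
    (psi : mxfamily R M m n -> \bar R) (r x0 : mxfamily R M m n) :
  (forall k, 0 < lambda k) -> pos_family r ->
  eproper psi -> lower_semicontinuous psi -> econvex psi ->
  pos_family x0 -> edom psi x0 ->
  [/\ pos_family (prox lambda psi r), psi (prox lambda psi r) \is a fin_num
    & argmin nonneg_family (objective lambda psi r) = [set prox lambda psi r]].
Proof.
move=> l0 r0 [psiNy _] psi_lsc psi_cvx x0_gt0 x0_dom.
have [p pmin] := argmin_exists l0 r0 psiNy psi_lsc psi_cvx x0_gt0 x0_dom.
have uniq q : argmin nonneg_family (objective lambda psi r) q -> q = p.
  by move=> qmin; apply: (argmin_unique l0 r0 psiNy psi_cvx x0_gt0 x0_dom).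
have -> : prox lambda psi r = p by exact: get_unique.
split; first exact: (argmin_pos l0 r0 psiNy psi_cvx x0_gt0 x0_dom pmin).
  by rewrite fin_numElt psiNy ltey; exact: (argmin_dom psiNy x0_gt0 x0_dom pmin).
by apply/seteqP; split=> [q /uniq|q ->].
Qed.

(** * Marginals and the chain rule *)

(** Chain rule: replacing the reference r j by r j * (P / Q) costs terms that are
linear in p and r, and these sum to kl P Q. *)
Lemma sum_kl (R : realType) (n : nat) (p r : 'I_n -> R) :
  (forall j, 0 <= p j) -> (forall j, 0 < r j) ->
  let P := \sum_j p j in let Q := \sum_j r j in
  \sum_j kl (p j) (r j) = kl P Q + \sum_j kl (p j) (r j * (P / Q)).
Proof.
move=> p0 r0 P Q.
(* If P = 0, all p j vanish and the new references are 0. *)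
have [P0|P0] := eqVneq P 0.
  have pj0 j : p j = 0.
    have /eqP := P0; rewrite psumr_eq0// => /allP/(_ j (mem_index_enum _)).
    by move=> /eqP.
  rewrite P0 kl0 mul0r [X in _ = _ + X]big1 ?addr0.
    by apply: eq_bigr => j _; rewrite pj0 kl0.
  by move=> j _; rewrite mulr0 pj0 kl0.
have Pgt0 : 0 < P by rewrite lt_neqAle eq_sym P0 sumr_ge0.
have Qgt0 : 0 < Q.
  rewrite lt_neqAle sumr_ge0 ?andbT => [|j _]; last exact: ltW.
  apply/eqP => /esym /eqP; rewrite psumr_eq0 => [/allP rj0|j _]; last exact: ltW.
  move: P0; rewrite /P big1 ?eqxx// => j _.
  by have /eqP rj := rj0 j (mem_index_enum _); have := r0 j; rewrite rj ltxx.
have PQ0 : 0 < P / Q by rewrite divr_gt0.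
transitivity (\sum_j (kl (p j) (r j * (P / Q)) +
    (p j * ln (P / Q) + (1 - P / Q) * r j))).
  apply: eq_bigr => j _; rewrite (@kl_change_ref _ _ (r j * (P / Q)))//;
    last exact: mulr_gt0 (r0 j) PQ0.
  rewrite [r j * (P / Q) / r j]mulrAC divff ?gt_eqF// mul1r; ring.
rewrite big_split/= [RHS]addrC; congr (_ + _).
rewrite big_split/= -mulr_suml -mulr_sumr -/P -/Q /kl.
by field; rewrite gt_eqF.
Qed.

Section marginals.
Context {R : realType} {M N : nat}.
Implicit Types (x y r : mxfamily R M N N) (p : mxfamily R M N 1).

Definition scale_rows r p : mxfamily R M N N := fun k =>
  \matrix_(i, j) (r k i j * (p k i 0 / row_marginals r k i 0)).

Lemma row_marginalsE x k i j : row_marginals x k i j = \sum_l x k i l.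
Proof. by rewrite mxE; apply: eq_bigr => l _; rewrite mxE mulr1. Qed.

Lemma row_marginals_nonneg x : nonneg_family x -> nonneg_family (row_marginals x).
Proof. by move=> x0 k i j; rewrite row_marginalsE sumr_ge0. Qed.

Lemma row_marginals_pos x : pos_family x -> pos_family (row_marginals x).
Proof.
move=> x0 k i j; rewrite row_marginalsE (bigD1 i)//= ltr_wpDr//.
by rewrite sumr_ge0// => l _; exact: ltW.
Qed.

Lemma scale_rows_pos r p : pos_family r -> pos_family p ->
  pos_family (scale_rows r p).
Proof.
move=> r0 p0 k i j; rewrite mxE mulr_gt0// divr_gt0//.
exact: row_marginals_pos.
Qed.

Lemma row_marginals_scale_rows r p : pos_family r ->
  row_marginals (scale_rows r p) = p.
Proof.
move=> r0; apply/funext => k; apply/matrixP => i j.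
rewrite row_marginalsE (eq_bigr (fun l => r k i l * (p k i 0 / row_marginals r k i 0))).
  rewrite -mulr_suml -(row_marginalsE r k i 0) (ord1 j) mulrCA divff ?mulr1//.
  by rewrite gt_eqF// row_marginals_pos.
by move=> l _; rewrite mxE.
Qed.

Lemma KL_weighted_row_marginals lambda x r : nonneg_family x -> pos_family r ->
  KL_weighted lambda x r = KL_weighted lambda (row_marginals x) (row_marginals r)
    + KL_weighted lambda x (scale_rows r (row_marginals x)).
Proof.
move=> x0 r0; rewrite -big_split/=; apply: eq_bigr => k _; rewrite -mulrDr.
congr (_ * _); rewrite -big_split/=; apply: eq_bigr => i _.
rewrite (sum_kl (x0 k i) (r0 k i)) big_ord1 !row_marginalsE; congr (_ + _).
by apply: eq_bigr => j _; rewrite mxE !row_marginalsE.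
Qed.

(** The reference has a zero row where x has one; there every term is kl 0 0 = 0. *)
Lemma KL_weighted_scale_rows_ge0 lambda x r : (forall k, 0 < lambda k) ->
  nonneg_family x -> pos_family r ->
  0 <= KL_weighted lambda x (scale_rows r (row_marginals x)).
Proof.
move=> l0 x0 r0; rewrite KL_weightedE; apply: sumr_ge0 => -[[k i] j] _ /=.
apply: mulr_ge0; first exact: ltW.
have Q0 := row_marginals_pos r0 k i 0.
rewrite [scale_rows _ _ _ _ _]mxE; have [P0|P0] := eqVneq (row_marginals x k i 0) 0.
  have -> : x k i j = 0.
    move/eqP: P0; rewrite row_marginalsE psumr_eq0// => /allP.
    by move=> /(_ j (mem_index_enum _))/eqP.
  by rewrite P0 mul0r mulr0 klxx.
have P1 : 0 < row_marginals x k i 0.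
  by rewrite lt_neqAle eq_sym P0 row_marginals_nonneg.
by apply: kl_ge0 => //; rewrite mulr_gt0// divr_gt0.
Qed.

(** The chain rule bounds the matrix objective at x below by the vector
objective at the row sums of x, with equality exactly at the row scalings of r. *)
Lemma argmin_row_marginals lambda (psi : mxfamily R M N 1 -> \bar R)
    (phi : mxfamily R M N N -> \bar R) r p :
  (forall k, 0 < lambda k) -> pos_family r ->
  (forall x, phi x = psi (row_marginals x)) -> pos_family p ->
  argmin nonneg_family (objective lambda psi (row_marginals r)) = [set p] ->
  psi p \is a fin_num ->
  argmin nonneg_family (objective lambda phi r) = [set scale_rows r p].
Proof.
move=> l0 r0 phiE p0 pargmin pfin.
have S0 := scale_rows_pos r0 p0; set S := scale_rows r p in S0 *.
have [_ pmin] : argmin nonneg_family (objective lambda psi (row_marginals r)) p.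
  by rewrite pargmin.
have rowS : row_marginals S = p by exact: row_marginals_scale_rows.
have FS : objective lambda phi r S = objective lambda psi (row_marginals r) p.
  rewrite /objective phiE KL_weighted_row_marginals// ?rowS ?KL_weightedxx ?addr0//;
  exact: pos_family_nonneg.
have Fge x : nonneg_family x ->
    (objective lambda psi (row_marginals r) (row_marginals x) +
       (KL_weighted lambda x (scale_rows r (row_marginals x)))%:E =
     objective lambda phi r x)%E.
  move=> xge0; rewrite /objective phiE [in RHS]KL_weighted_row_marginals//.
  by rewrite EFinD addeAC.
have Fge_row x : nonneg_family x ->
    (objective lambda psi (row_marginals r) (row_marginals x) <=
     objective lambda phi r x)%E.
  move=> xge0; rewrite -Fge// leeDl// lee_fin.
  exact: KL_weighted_scale_rows_ge0.
apply/seteqP; split=> [x [xge0 xmin]|_ ->]; last first.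
  split=> [|y y0]; first exact: pos_family_nonneg.
  by rewrite FS (le_trans _ (Fge_row _ y0))// pmin//; exact: row_marginals_nonneg.
have xS : (objective lambda phi r x <= objective lambda psi (row_marginals r) p)%E.
  by rewrite -FS xmin//; exact: pos_family_nonneg.
have rowx : row_marginals x = p.
  have : [set p] (row_marginals x); last by [].
  rewrite -pargmin; split; first exact: row_marginals_nonneg.
  by move=> q q0; rewrite (le_trans (Fge_row _ xge0))// (le_trans xS)// pmin.
apply: (KL_weighted_eq0 l0 xge0 S0).
move: xS; rewrite -Fge// rowx -[X in (_ <= X)%E]adde0 leeD2lE ?lee_fin//.
by rewrite /objective fin_numD pfin.
Qed.

Definition tr_family x : mxfamily R M N N := fun k => (x k)^T.

Lemma tr_familyK : involutive tr_family.
Proof. by move=> x; apply/funext => k; exact: trmxK. Qed.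

Lemma KL_weighted_tr lambda x r :
  KL_weighted lambda (tr_family x) (tr_family r) = KL_weighted lambda x r.
Proof.
apply: eq_bigr => k _; congr (_ * _); rewrite /KL exchange_big/=.
by apply: eq_bigr => i _; apply: eq_bigr => j _; rewrite !mxE.
Qed.

Lemma argmin_tr lambda (phi : mxfamily R M N N -> \bar R) r :
  argmin nonneg_family (objective lambda phi r) =
  tr_family @^-1` argmin nonneg_family
    (objective lambda (phi \o tr_family) (tr_family r)).
Proof.
have nonneg_tr x : nonneg_family (tr_family x) <-> nonneg_family x.
  by split=> x0 k i j; have := x0 k j i; rewrite mxE.
have objE x : objective lambda (phi \o tr_family) (tr_family r) (tr_family x) =
    objective lambda phi r x.
  by rewrite /objective KL_weighted_tr/= tr_familyK.
apply/seteqP; split=> x [x0 xmin]; (split; first exact/nonneg_tr) => y y0.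
  by rewrite objE -[y]tr_familyK objE xmin//; exact/nonneg_tr.
by rewrite -!objE xmin//; exact/nonneg_tr.
Qed.

End marginals.

Lemma prox_row_marginals (R : realType) (M N : nat) (lambda : 'I_M -> R)
    (psi : mxfamily R M N 1 -> \bar R) (phi : mxfamily R M N N -> \bar R)
    (r : mxfamily R M N N) (p : mxfamily R M N 1) :
  (forall k, 0 < lambda k) -> pos_family r ->
  (forall x, phi x = psi (row_marginals x)) -> pos_family p ->
  argmin nonneg_family (objective lambda psi (row_marginals r)) = [set p] ->
  psi p \is a fin_num ->
  prox lambda phi r = scale_rows r p.
Proof.
move=> l0 r0 phiE p0 pmin pfin.
by apply: get_unique; rewrite [argmin _ _](argmin_row_marginals l0 r0 phiE p0 pmin pfin).
Qed.

Lemma prox_col_marginals (R : realType) (M N : nat) (lambda : 'I_M -> R)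
    (psi : mxfamily R M N 1 -> \bar R) (phi : mxfamily R M N N -> \bar R)
    (r : mxfamily R M N N) (p : mxfamily R M N 1) :
  (forall k, 0 < lambda k) -> pos_family r ->
  (forall x, phi x = psi (col_marginals x)) -> pos_family p ->
  argmin nonneg_family (objective lambda psi (col_marginals r)) = [set p] ->
  psi p \is a fin_num ->
  prox lambda phi r = tr_family (scale_rows (tr_family r) p).
Proof.
move=> l0 r0 phiE p0 pmin pfin.
have r0' : pos_family (tr_family r) by move=> k i j; rewrite mxE.
have phiE' x : (phi \o tr_family) x = psi (row_marginals x).
  by rewrite /= phiE -[x in RHS]tr_familyK.
have argminE : argmin nonneg_family (objective lambda phi r) =
    [set tr_family (scale_rows (tr_family r) p)].
  rewrite argmin_tr (argmin_row_marginals l0 r0' phiE' p0 pmin pfin).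
  apply/seteqP; split=> x /=; last by move=> ->; rewrite tr_familyK.
  by move=> <-; rewrite tr_familyK.
by apply: get_unique; rewrite [argmin _ _]argminE.
Qed.

(** * Relative interiors *)

Lemma relative_interior_sub (R : realType) (M m n : nat) (A : set (mxfamily R M m n)) :
  relative_interior A `<=` A.
Proof. by move=> x [Ax /nbhs_singleton]; exact. Qed.

(** Lower the entry (k, i, j) of x by a small e: the result y e stays in the
affine hull, as y e = 2 x - y (- e) with y (- e) nonnegative, and it is close to
x, hence nonnegative.  So the entry is at least e. *)
Lemma relative_interior_nonneg (R : realType) (M m n : nat) :
  relative_interior (@nonneg_family R M m n) `<=` pos_family.
Proof.
move=> x xri; have x0 := relative_interior_sub xri; case: xri => _ nbx k i j.
pose y (e : R) : mxfamily R M m n := dfwith x k (x k - e *: delta_mx i j).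
have yE e k' i' j' : y e k' i' j' =
    x k' i' j' - e * [&& k' == k, i' == i & j' == j]%:R.
  rewrite /y; case: dfwithP => [|l kl]; first by rewrite !mxE eqxx.
  by rewrite eq_sym (negbTE kl)/= mulr0 subr0.
have y0 : y 0 = x.
  by apply/funext => k'; apply/matrixP => i' j'; rewrite yE mul0r subr0.
have cy : {for 0, continuous y}.
  have cx : (fun e : R => x k - e *: delta_mx i j) @ (0 : R) --> x k - 0 *: delta_mx i j.
    apply: cvgB; first exact: cvg_cst.
    by apply: cvgZ; [exact: cvg_id|exact: cvg_cst].
  exact: cvg_comp cx (@dfwith_continuous _ (fun=> 'M[R]_(m, n)) x k _).
have /nbhs_ballP[d /= d0 dy] : \forall e \near (0 : R),
    affine_hull nonneg_family (y e) -> nonneg_family (y e).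
  by have := cy _; rewrite y0 => /(_ _ nbx).
have e0 : 0 < d / 2 by rewrite divr_gt0.
have affy : affine_hull nonneg_family (y (d / 2)).
  exists 2, (fun l : 'I_2 => if l == 0 then 2 else -1),
   (fun l : 'I_2 => if l == 0 then x else y (- (d / 2))); split.
  - move=> l; case: ifP => // _ k' i' j'; rewrite yE mulNr opprK.
    by rewrite addr_ge0// mulr_ge0// ltW.
  - by rewrite !big_ord_recl big_ord0/=; lra.
  - apply/funext => k'; apply/matrixP => i' j'.
    rewrite !big_ord_recl big_ord0/= addr0 fctE !mxE !yE; ring.
have bd : ball (0 : R) d (d / 2).
  by rewrite /ball /= sub0r normrN gtr0_norm//; lra.
have := dy _ bd affy k i j; rewrite yE !eqxx mulr1 subr_ge0.
exact: lt_le_trans.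
Qed.

(** * Diagonal scalings and one step of the algorithm *)

Section diagonal_scalings.
Context {R : realType} {M N : nat}.
Implicit Types (xi : mxfamily R M N N) (a b u v p : mxfamily R M N 1).

Definition diag_scaling xi a b : mxfamily R M N N :=
  fun k => \matrix_(i, j) (a k i 0 * xi k i j * b k j 0).

Definition outer u v : mxfamily R M N N :=
  fun k => \matrix_(i, j) (u k i 0 * v k j 0).

Lemma diag_scalingE xi a b k :
  diag_scaling xi a b k = diag_mx (a k)^T *m xi k *m diag_mx (b k)^T.
Proof. by rewrite mul_mx_diag mul_diag_mx; apply/matrixP => i j; rewrite !mxE. Qed.

Lemma outerE u v k : outer u v k = u k *m (v k)^T.
Proof. by apply/matrixP => i j; rewrite !mxE big_ord1 !mxE. Qed.

Lemma diag_scaling_one xi : diag_scaling xi fam_one fam_one = xi.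
Proof.
by apply/funext => k; apply/matrixP => i j; rewrite !mxE mul1r mulr1.
Qed.

Lemma outer_one : outer fam_one fam_one = fam_one.
Proof. by apply/funext => k; apply/matrixP => i j; rewrite !mxE mul1r. Qed.

Lemma diag_scaling_odot_outer xi a b u v :
  diag_scaling xi a b \odot outer u v = diag_scaling xi (a \odot u) (b \odot v).
Proof. by apply/funext => k; apply/matrixP => i j; rewrite !mxE; ring. Qed.

Lemma outer_odot_oslash xi a b a' b' u v :
  pos_family xi -> pos_family a' -> pos_family b' ->
  outer u v \odot (diag_scaling xi a b \oslash diag_scaling xi a' b') =
  outer (u \odot (a \oslash a')) (v \odot (b \oslash b')).
Proof.
move=> xi0 a0 b0; apply/funext => k; apply/matrixP => i j; rewrite !mxE.
by field; rewrite !gt_eqF.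
Qed.

Lemma tr_diag_scaling xi a b :
  tr_family (diag_scaling xi a b) = diag_scaling (tr_family xi) b a.
Proof. by apply/funext => k; apply/matrixP => i j; rewrite !mxE; ring. Qed.

Lemma odot_pos m n (x y : mxfamily R M m n) :
  pos_family x -> pos_family y -> pos_family (x \odot y).
Proof. by move=> x0 y0 k i j; rewrite mxE mulr_gt0. Qed.

Lemma oslash_pos m n (x y : mxfamily R M m n) :
  pos_family x -> pos_family y -> pos_family (x \oslash y).
Proof. by move=> x0 y0 k i j; rewrite mxE divr_gt0. Qed.

Lemma fam_one_pos m n : pos_family (@fam_one R M m n).
Proof. by move=> k i j; rewrite mxE. Qed.

Lemma mulmx_pos xi b : pos_family xi -> pos_family b ->
  pos_family ((fun k => xi k *m b k) : mxfamily R M N 1).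
Proof.
move=> xi0 b0 k i j; rewrite mxE (bigD1 i)//= ltr_wpDr ?mulr_gt0//.
by rewrite sumr_ge0// => l _; rewrite mulr_ge0// ltW.
Qed.

Lemma diag_scaling_pos xi a b : pos_family xi -> pos_family a -> pos_family b ->
  pos_family (diag_scaling xi a b).
Proof. by move=> xi0 a0 b0 k i j; rewrite mxE !mulr_gt0. Qed.

Lemma row_marginals_diag_scaling xi a b :
  row_marginals (diag_scaling xi a b) = a \odot (fun k => xi k *m b k).
Proof.
apply/funext => k; apply/matrixP => i j; rewrite row_marginalsE !mxE mulr_sumr.
by apply: eq_bigr => l _; rewrite !mxE (ord1 j) mulrA.
Qed.

Lemma scale_rows_diag_scaling xi a b p :
  pos_family xi -> pos_family a -> pos_family b ->
  scale_rows (diag_scaling xi a b) p =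
  diag_scaling xi (p \oslash (fun k => xi k *m b k)) b.
Proof.
move=> xi0 a0 b0; apply/funext => k; apply/matrixP => i j.
have xib0 := mulmx_pos xi0 b0 k i 0.
rewrite mxE row_marginals_diag_scaling [in RHS]mxE 2![in LHS]mxE [in RHS]mxE.
by field; rewrite !gt_eqF.
Qed.

End diagonal_scalings.

(** The row sums of diag(a) xi diag(b) are a * (xi b), so rescaling them to p
replaces a by p / (xi b). *)
Lemma dykstra_row_step (R : realType) (M N : nat) (lambda : 'I_M -> R)
    (psi : mxfamily R M N 1 -> \bar R) (phi : mxfamily R M N N -> \bar R)
    (xi : mxfamily R M N N) (a b x0 : mxfamily R M N 1) :
  (forall k, 0 < lambda k) -> pos_family xi ->
  eproper psi -> lower_semicontinuous psi -> econvex psi ->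
  (forall x, phi x = psi (row_marginals x)) ->
  pos_family x0 -> edom psi x0 -> pos_family a -> pos_family b ->
  let xib : mxfamily R M N 1 := fun k => xi k *m b k in
  let a' := prox lambda psi (a \odot xib) \oslash xib in
  pos_family a' /\
  prox lambda phi (diag_scaling xi a b) = diag_scaling xi a' b.
Proof.
move=> l0 xi0 pr lsc cvx phiE x0_gt0 x0_dom a0 b0 xib a'.
have xib0 : pos_family xib by exact: mulmx_pos.
have [p0 pfin pmin] := prox_spec l0 (odot_pos a0 xib0) pr lsc cvx x0_gt0 x0_dom.
split; first exact: oslash_pos.
rewrite (prox_row_marginals l0 (diag_scaling_pos xi0 a0 b0) phiE p0 _ pfin).
  by rewrite scale_rows_diag_scaling.
by rewrite row_marginals_diag_scaling.
Qed.

(** The row step for the transpose, diag(b) xi^T diag(a). *)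
Lemma dykstra_col_step (R : realType) (M N : nat) (lambda : 'I_M -> R)
    (psi : mxfamily R M N 1 -> \bar R) (phi : mxfamily R M N N -> \bar R)
    (xi : mxfamily R M N N) (a b x0 : mxfamily R M N 1) :
  (forall k, 0 < lambda k) -> pos_family xi ->
  eproper psi -> lower_semicontinuous psi -> econvex psi ->
  (forall x, phi x = psi (col_marginals x)) ->
  pos_family x0 -> edom psi x0 -> pos_family a -> pos_family b ->
  let xiTa : mxfamily R M N 1 := fun k => (xi k)^T *m a k in
  let b' := prox lambda psi (b \odot xiTa) \oslash xiTa in
  pos_family b' /\
  prox lambda phi (diag_scaling xi a b) = diag_scaling xi a b'.
Proof.
move=> l0 xi0 pr lsc cvx phiE x0_gt0 x0_dom a0 b0 xiTa b'.
have xiT0 : pos_family (tr_family xi) by move=> k i j; rewrite mxE.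
have xiTa0 : pos_family xiTa by exact: mulmx_pos.
have [p0 pfin pmin] := prox_spec l0 (odot_pos b0 xiTa0) pr lsc cvx x0_gt0 x0_dom.
split; first exact: oslash_pos.
rewrite (prox_col_marginals l0 (diag_scaling_pos xi0 a0 b0) phiE p0 _ pfin).
  by rewrite tr_diag_scaling scale_rows_diag_scaling// tr_diag_scaling tr_familyK.
rewrite (_ : col_marginals _ = row_marginals (tr_family (diag_scaling xi a b)))//.
by rewrite tr_diag_scaling row_marginals_diag_scaling.
Qed.

(** * Factorization of the iterates *)

Theorem proposition5p2 (R : realType) (M N : nat)
    (lambda : 'I_M -> R) (xi : mxfamily R M N N)
    (psi1 psi2 : mxfamily R M N 1 -> \bar R)
    (phi1 phi2 : mxfamily R M N N -> \bar R)
    (pi z : int -> mxfamily R M N N) (a b u v : int -> mxfamily R M N 1) :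
  (forall m, 0 < lambda m) ->
  (forall m i j, 0 < xi m i j) ->
  eproper psi1 -> lower_semicontinuous psi1 -> econvex psi1 ->
  eproper psi2 -> lower_semicontinuous psi2 -> econvex psi2 ->
  (forall rho, phi1 rho = psi1 (row_marginals rho)) ->
  (forall rho, phi2 rho = psi2 (col_marginals rho)) ->
  relative_interior (edom phi1) `&` relative_interior (edom phi2) `&`
    relative_interior (@nonneg_family R M N N) !=set0 ->
  dykstra_iterates lambda xi phi1 phi2 pi z ->
  scaling_iterates lambda xi psi1 psi2 a b u v ->
  (forall (l : int) (m : 'I_M), 0 <= l ->
     pi l m = diag_mx (a l m)^T *m xi m *m diag_mx (b l m)^T) /\
  (forall (l : int) (m : 'I_M), -1 <= l ->
     z l m = u l m *m (v l m)^T).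
Proof.
move=> l0 xi0 pr1 lsc1 cvx1 pr2 lsc2 cvx2 phi1E phi2E.
move=> [w [[/relative_interior_sub w1 /relative_interior_sub w2]]].
move=> /relative_interior_nonneg w0.
move=> [pi0 z0 zN1 dykstra] [[a0 b0] [u0 v0] [uN1 vN1] scaling].
have row_w0 := row_marginals_pos w0.
have col_w0 : pos_family (col_marginals w).
  have trw0 : pos_family (tr_family w) by move=> k i j; rewrite mxE.
  exact: (row_marginals_pos trw0).
have row_w_dom : edom psi1 (row_marginals w) by rewrite /edom/= -phi1E.
have col_w_dom : edom psi2 (col_marginals w) by rewrite /edom/= -phi2E.
have one_pos := @fam_one_pos R M N 1.
(* The recursion for z reaches back two steps, hence the terms at l - 1. *)
have invariant (n : nat) : let l := n%:Z in
  [/\ [/\ pos_family (a l), pos_family (b l), pos_family (u l) & pos_family (v l)],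
      pos_family (u (l - 1)) /\ pos_family (v (l - 1)),
      pi l = diag_scaling xi (a l) (b l),
      z l = outer (u l) (v l)
    & z (l - 1) = outer (u (l - 1)) (v (l - 1))].
  elim: n => [|n /= [[an bn un vn] [un1 vn1] pin zn zn1]] /=.
    by rewrite sub0r a0 b0 u0 v0 uN1 vN1 pi0 z0 zN1 diag_scaling_one outer_one; split.
  have l1 : n.+1%:Z - 1 = n%:Z by rewrite intS; ring.
  have l2 : n.+1%:Z - 2 = n%:Z - 1 by rewrite intS; ring.
  have lgt0 : 0 < n.+1%:Z by [].
  have [piS zS] := dykstra _ lgt0; have [aS bS uS vS] := scaling _ lgt0.
  rewrite l1 l2 in piS zS aS bS uS vS *.
  have a'0 := odot_pos an un1; have b'0 := odot_pos bn vn1.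
  rewrite pin zn1 diag_scaling_odot_outer in piS.
  have [aS0 bS0 {}piS] : [/\ pos_family (a n.+1), pos_family (b n.+1) &
      pi n.+1 = diag_scaling xi (a n.+1) (b n.+1)].
    move: piS aS bS; rewrite /alt; case: ifP => _ -> -> ->.
      have [? ->] := dykstra_row_step l0 xi0 pr1 lsc1 cvx1 phi1E row_w0 row_w_dom a'0 b'0.
      by split.
    have [? ->] := dykstra_col_step l0 xi0 pr2 lsc2 cvx2 phi2E col_w0 col_w_dom a'0 b'0.
    by split.
  split => //.
    by split => //; rewrite ?uS ?vS; do ?[apply: odot_pos|apply: oslash_pos].
  by rewrite zS zn1 pin piS uS vS outer_odot_oslash.
split=> [[n|//] m _|[n|[|//]] m _].
- by have [_ _ -> _ _] := invariant n; rewrite diag_scalingE.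
- by have [_ _ _ -> _] := invariant n; rewrite outerE.
- have [_ _ _ _] := invariant 0; rewrite sub0r => zE.
  by rewrite NegzE zE outerE.
Qed.
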